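(* Let $G=K_{m,n}$ be the complete bipartite graph on $[m+n]=\{1,\ldots,m+n\}$ with vertex partition $[m]\sqcup([m+n]\setminus[m])$, where $m,n\ge 1$, and let $\mathfrak{c}=(c_1,\ldots,c_{m+n})\in(\mathbb{Z}_{>0})^{m+n}$. Suppose that $$c_1+\cdots+c_m>c_{m+1}+\cdots+c_{m+n}\geq m+1$$ and that $c_i\leq c_{m+1}+\cdots+c_{m+n}$ for each $i\in[m]$. Set $$A:=\{i\in[m]: c_i=c_{m+1}+\cdots+c_{m+n}\},\qquad B:=[m]\setminus A,$$ and suppose that $c_i\geq 2$ for each $i\in B\cup([m+n]\setminus[m])$. Then $\operatorname{conv}(\mathcal{D}(G,\mathfrak{c}))\subset\mathbb{R}^{m+n}$, which is the polytope defined by the system of linear inequalities - $0\leq x_i\leq c_i$ for $i=m+1,\ldots,m+n$; - $0\leq x_i\leq c_i$ for $i\in B$; - $0\leq x_i$ for $i\in A$; - $x_1+\cdots+x_m\leq c_{m+1}+\cdots+c_{m+n}$, is level* if and only if both of the following conditions are satisfied. (i) There is no subset $\emptyset\neq X\subset B$ for which $$c_{m+1}+\cdots+c_{m+n}<\sum_{i\in X}c_i<c_{m+1}+\cdots+c_{m+n}-m+2|X|-1.$$ (ii) There is no subset $\emptyset\neq X\subset[m]$ for which $$\sum_{i=1}^{m}c_i-\sum_{i\in X}c_i<c_{m+1}+\cdots+c_{m+n}\leq 2|X|+\sum_{i=1}^{m}c_i-\sum_{i\in X}c_i-m.$$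
   Context: Inclusions $X\subset Y$ allow equality. Let $G$ be a finite graph with no loops, no multiple edges and no isolated vertices on the vertex set $\{x_1,\ldots,x_N\}$ (identified with $[N]$), $N\geq 2$. Let $S=K[x_1,\ldots,x_N]$ be the polynomial ring over a field $K$, and let the edge ideal $I(G)\subset S$ be the ideal generated by the monomials $x_ix_j$ with $\{x_i,x_j\}$ an edge of $G$. For $\mathfrak{c}=(c_1,\ldots,c_N)\in(\mathbb{Z}_{>0})^N$ and an integer $q\geq 1$, let $(I(G)^q)_{\mathfrak{c}}$ be the ideal of $S$ generated by those monomials $x_1^{a_1}\cdots x_N^{a_N}\in I(G)^q$ with $a_i\leq c_i$ for all $i$. Let $\delta_{\mathfrak{c}}(I(G))$ be the largest integer $q$ with $(I(G)^q)_{\mathfrak{c}}\neq(0)$, and let $\mathcal{B}(G,\mathfrak{c})$ be the minimal set of monomial generators of $(I(G)^{\delta_{\mathfrak{c}}(I(G))})_{\mathfrak{c}}$. Let $\mathcal{D}(G,\mathfrak{c})$ be the set of all $(a_1,\ldots,a_N)\in\mathbb{Z}_{\geq 0}^N$ such that $x_1^{a_1}\cdots x_N^{a_N}$ divides some $u\in\mathcal{B}(G,\mathfrak{c})$, and let $\operatorname{conv}(\mathcal{D}(G,\mathfrak{c}))\subset\mathbb{R}^N$ be its convex hull. A lattice polytope $\mathcal{P}\subset\mathbb{R}^N$ of dimension $N$ (all vertices in $\mathbb{Z}^N$) is normal if for each $k\geq 2$ every $\mathbf{a}\in k\mathcal{P}\cap\mathbb{Z}^N$ is a sum of $k$ elements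 of $\mathcal{P}\cap\mathbb{Z}^N$, where $k\mathcal{P}=\{k\mathbf{b}:\mathbf{b}\in\mathcal{P}\}$. (It is known that $\operatorname{conv}(\mathcal{D}(G,\mathfrak{c}))$ is a normal lattice polytope of dimension $N$.) A lattice polytope $\mathcal{P}\subset\mathbb{R}^N$ of dimension $N$ is level* if it is normal, $(\mathcal{P}\setminus\partial\mathcal{P})\cap\mathbb{Z}^N\neq\emptyset$, and for each $k\geq 2$ and each $\mathbf{a}\in k(\mathcal{P}\setminus\partial\mathcal{P})\cap\mathbb{Z}^N$ there exist $\mathbf{a}_0\in(\mathcal{P}\setminus\partial\mathcal{P})\cap\mathbb{Z}^N$ and $\mathbf{a}'\in(k-1)\mathcal{P}\cap\mathbb{Z}^N$ with $\mathbf{a}=\mathbf{a}_0+\mathbf{a}'$. Here $\mathcal{P}\setminus\partial\mathcal{P}$ is the interior of $\mathcal{P}$. *)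

(* Defs.v *)
From HB Require Import structures.
From mathcomp Require Import all_boot all_order all_algebra.
From mathcomp Require Import all_classical all_reals all_analysis.
(* The notations of [mpoly] clash with those of the analysis library. *)
From mathcomp Require Import -(notations) mpoly.
Set Implicit Arguments.
Unset Strict Implicit.
Unset Printing Implicit Defensive.
Import Order.TTheory GRing.Theory Num.Theory.
Import numFieldNormedType.Exports.

Local Open Scope classical_set_scope.
Local Open Scope ring_scope.

Section Ideals.
Variable S : comNzRingType.

Definition ideal_gen (E : set S) : set S :=
  [set p | exists2 s : seq (S * S),
     (forall rg, rg \in s -> E rg.2) & p = \sum_(rg <- s) rg.1 * rg.2].

Definition ideal_mul (I J : set S) : set S :=
  ideal_gen [set p * q | p in I & q in J].

Definition ideal_pow (I : set S) (q : nat) : set S :=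
  iter q (ideal_mul I) setT.

Definition ring_dvd (p q : S) : Prop := exists r, q = r * p.

End Ideals.

Section MonomialIdeals.
Variables (K : fieldType) (N : nat).

(* The polynomial ring K[x_1, ..., x_N], the monomial x^a, the variable x_i;
   the variables are indexed by 'I_N, i.e. from 0. *)
Local Notation S := (mpoly.mpoly N K).
Local Notation mon := (mpoly.multinom N).
Local Notation "''x^' a" := (@mpoly.mpolyX N K a) (at level 8, a at level 2).
Local Notation "''x_' i" := (@mpoly.mpolyX N K (mpoly.mnm1 i))
  (at level 8, i at level 2).

Definition edge_ideal (adj : rel 'I_N) : set S :=
  ideal_gen [set p : S | exists i j, adj i j /\ p = 'x_i * 'x_j].

Definition bounded_part (c : 'I_N -> nat) (J : set S) : set S :=
  ideal_gen [set p : S | exists a : mon,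
    [/\ p = 'x^a, J 'x^a & forall i, (a i <= c i)%N]].

Definition nonzero_power (c : 'I_N -> nat) (I : set S) (q : nat) : Prop :=
  bounded_part c (ideal_pow I q) <> [set 0].

Definition is_delta (c : 'I_N -> nat) (I : set S) (q : nat) : Prop :=
  [/\ (1 <= q)%N, nonzero_power c I q &
      forall q', (1 <= q')%N -> nonzero_power c I q' -> (q' <= q)%N].

(* The largest q >= 1 with nonzero bounded part (0 if there is none). *)
Definition delta (c : 'I_N -> nat) (I : set S) : nat :=
  xget 0%N [set q | is_delta c I q].

Definition mon_ideal (U : set mon) : set S := ideal_gen [set 'x^a | a in U].

Definition is_min_mon_gens (J : set S) (U : set mon) : Prop :=
  mon_ideal U = J /\ forall V, V `<=` U -> mon_ideal V = J -> V = U.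

(* The minimal set of monomial generators, as a set of exponent vectors; it
   exists and is unique when J is a monomial ideal. *)
Definition min_mon_gens (J : set S) : set mon :=
  xget set0 [set U | is_min_mon_gens J U].

Definition calB (adj : rel 'I_N) (c : 'I_N -> nat) : set mon :=
  let I := edge_ideal adj in
  min_mon_gens (bounded_part c (ideal_pow I (delta c I))).

Definition calD (adj : rel 'I_N) (c : 'I_N -> nat) : set mon :=
  [set a | exists2 u, calB adj c u & ring_dvd 'x^a 'x^u].

End MonomialIdeals.

Section Polytopes.
Variables (R : realType) (N : nat).
Local Notation V := 'rV[R]_N.

Definition lattice : set V := [set x | forall i, x 0 i \is a Num.int].

Definition conv_hull (E : set V) : set V := smallest (@convex_set R V) E.

Definition polytope (P : set V) : Prop :=
  exists s : seq V, P = conv_hull [set` s].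

Definition vertex (P : set V) (v : V) : Prop :=
  P v /\ forall (x y : V) (t : R), P x -> P y -> 0 < t < 1 ->
    v = t *: x + (1 - t) *: y -> x = y.

(* P has dimension N: it contains N + 1 affinely independent points. *)
Definition full_dim (P : set V) : Prop :=
  exists (p : V) (v : 'I_N -> V),
    [/\ P p, forall i, P (v i) & \matrix_i (v i - p) \in unitmx].

Definition full_lattice_polytope (P : set V) : Prop :=
  [/\ polytope P, vertex P `<=` lattice & full_dim P].

Definition dilate (k : nat) (P : set V) : set V := [set k%:R *: b | b in P].

Definition normal_polytope (P : set V) : Prop :=
  full_lattice_polytope P /\
  forall (k : nat) (a : V), (2 <= k)%N -> (dilate k P `&` lattice) a ->
    exists2 b : 'I_k -> V,
      (forall j, (P `&` lattice) (b j)) & a = \sum_j b j.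

Definition level_star (P : set V) : Prop :=
  [/\ normal_polytope P,
      P° `&` lattice !=set0 &
      forall (k : nat) (a : V), (2 <= k)%N -> (dilate k P° `&` lattice) a ->
        exists a0 a' : V,
          [/\ (P° `&` lattice) a0, (dilate k.-1 P `&` lattice) a' &
              a = a0 + a']].

Definition exponent_point (a : mpoly.multinom N) : V := \row_i (a i)%:R.

End Polytopes.

(* conv(D(G, c)) in R^N, the ideals being taken over the field K. *)
Definition convD (K : fieldType) (R : realType) (N : nat)
    (adj : rel 'I_N) (c : 'I_N -> nat) : set 'rV[R]_N :=
  conv_hull (@exponent_point R N @` calD K adj c).
Arguments convD K R {N} adj c.

Section CompleteBipartite.
Variables m n : nat.

(* The parts [m] and [m+n] \ [m] of the vertex set; vertices are numbered
   from 0. *)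
Definition lpart : {set 'I_(m + n)} := [set i : 'I_(m + n) | (i < m)%N]%SET.
Definition rpart : {set 'I_(m + n)} := (~: lpart)%SET.

Definition complete_bipartite : rel 'I_(m + n) :=
  fun i j => (i \in lpart) != (j \in lpart).

Definition csum (c : 'I_(m + n) -> nat) (X : {set 'I_(m + n)}) : nat :=
  (\sum_(i in X) c i)%N.

Definition setA (c : 'I_(m + n) -> nat) : {set 'I_(m + n)} :=
  [set i in lpart | c i == csum c rpart]%SET.

Definition setB (c : 'I_(m + n) -> nat) : {set 'I_(m + n)} :=
  (lpart :\: setA c)%SET.

Definition ineq_polytope (R : realType) (c : 'I_(m + n) -> nat) :
    set 'rV[R]_(m + n) :=
  [set x | [/\ forall i, i \in rpart -> 0 <= x 0 i <= (c i)%:R,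
               forall i, i \in setB c -> 0 <= x 0 i <= (c i)%:R,
               forall i, i \in setA c -> 0 <= x 0 i &
               \sum_(i in lpart) x 0 i <= (csum c rpart)%:R]].

End CompleteBipartite.
Arguments ineq_polytope {m n} R c.
Arguments complete_bipartite m n i j : clear implicits.

(* Main.v *)
Require Import Defs.
From HB Require Import structures.
From mathcomp Require Import all_boot all_order all_algebra.
From mathcomp Require Import all_classical all_reals all_analysis.
From mathcomp Require Import -(notations) mpoly.
From mathcomp Require Import zify ring lra.
Import Order.TTheory GRing.Theory Num.Theory.
Import numFieldNormedType.Exports.
Local Open Scope ring_scope.

(** Write [L] and [Q] for the two sides of the bipartition, [T] for the total
    capacity of [Q] and [m] for the size of [L].  A monomial lies in the q-th
    power of the edge ideal exactly when it has degree at least [q] on each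
    side ([monX_edge_pow]).  As [T] is smaller than the capacity of [L], the
    largest admissible power is [T] and its bounded minimal generators fill
    every vertex of [Q] and have degree [T] on [L].  Their divisors are the
    integer points of the box [0 <= x <= c] cut by [\sum_(i in L) x_i <= T]
    ([calD_bipartite]).  The bound [x_i <= c_i] follows from the cut when
    [c_i = T], so this truncated box is the polytope of the theorem.

    The truncated box is the convex hull of its integer points
    ([sum_box_lattice_hull]): from a point with a non-integer coordinate one can
    move in two opposite directions, [e_i] or [e_i - e_j], inside the polytope
    until one more coordinate becomes an integer.

    Let [a] be an integer point of the interior of the (k+1)-fold dilate.  The
    points [a0] that may be split off from [a] are the integer points of the box
      [max(1, a_i - k c_i) <= a0_i <= min(a_i, c_i - 1)]
    with [\sum_L a - k T <= \sum_L a0 <= T - 1].  Since integer vectors of a box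
    realise every sum between the two extreme ones ([box_sum_interpolation]), such
    an [a0] exists unless the lower bounds already add up to [T] or the upper
    bounds do not reach [\sum_L a - k T].  In the first case the coordinates of
    [L] where [a_i > k c_i] form a set [Y] with
      [c(Y) < T <= c(Y) + m - 2 #|Y|];
    in the second case those where [a_i >= c_i] form a set [Y] with
      [T < c(Y) < T - m + 2 #|Y| - 1].
    Conversely each such [Y] yields for large [k] a point [a], large
    on [Y] and equal to 1 elsewhere, that cannot be split
    ([lattice_levelP]).  Sets of the second kind are those of condition (i), and
    complements in [L] of sets of the first kind are those of condition (ii). *)

Set Implicit Arguments.
Unset Strict Implicit.
Unset Printing Implicit Defensive.

(** * Integer vectors of a box and their sums *)

Section SumInBox.
Local Open Scope nat_scope.
Variables (I : finType) (X : {set I}).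

(** Starting from [u], decrease one coordinate at a time: each step lowers the
    sum by exactly one, so that no value is skipped. *)
Lemma box_sum_interpolation (l u : I -> nat) (t : nat) :
  (forall i, l i <= u i) -> \sum_(i in X) l i <= t <= \sum_(i in X) u i ->
  exists2 a : I -> nat, forall i, l i <= a i <= u i & \sum_(i in X) a i = t.
Proof.
move=> lu /andP[lt]; have [d] := ubnP (\sum_(i in X) u i - t).
elim: d u lu => // d IH u lu ltd tu.
have [eq_t|neq_t] := eqVneq (\sum_(i in X) u i) t.
  by exists u => // i; rewrite lu leqnn.
have [i iX lti] : exists2 i, i \in X & l i < u i.
  apply/exists_inP; apply: contraPT lt => /exists_inPn lt_n.
  have : \sum_(i in X) u i <= \sum_(i in X) l i.
    by apply: leq_sum => i iX; have := lt_n i iX; lia.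
  lia.
pose u' j := if j == i then (u i).-1 else u j.
have sumu : \sum_(j in X) u j = (\sum_(j in X) u' j).+1.
  rewrite (bigD1 i) //= [in RHS](bigD1 i) //= {1}/u' eqxx.
  rewrite (eq_bigr u') => [|j /andP[_ /negPf ji]]; last by rewrite /u' ji.
  by rewrite -addSn prednK // (leq_ltn_trans _ lti).
have [|||a la sa] := IH u' => //.
- by move=> j; rewrite /u'; case: eqP => [->|_] //; lia.
- by clearbody u'; lia.
- by clearbody u'; lia.
exists a => // j; have := la j; rewrite /u'; case: eqP => [->|_] //.
lia.
Qed.

(** The left end of the target interval may lie below [\sum l] and the right
    end above [\sum u]. *)
Lemma box_sum_between (l u : I -> nat) (p q : nat) :
  (forall i, l i <= u i) -> p <= q -> \sum_(i in X) l i <= q ->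
  p <= \sum_(i in X) u i ->
  exists2 a : I -> nat, forall i, l i <= a i <= u i &
    p <= \sum_(i in X) a i <= q.
Proof.
move=> lu pq lq pu.
have lus : \sum_(i in X) l i <= \sum_(i in X) u i by apply: leq_sum.
have [|a la sa] := @box_sum_interpolation l u (maxn p (\sum_(i in X) l i)) lu.
  lia.
by exists a => //; rewrite sa; lia.
Qed.

Lemma eq_of_sum_le (f g : I -> nat) :
  (forall i, f i <= g i) -> \sum_(i in X) g i <= \sum_(i in X) f i ->
  forall i, i \in X -> f i = g i.
Proof.
move=> fg gf i iX; apply/eqP; rewrite eqn_leq fg /=.
move: gf; rewrite !(big_setD1 i iX) /=.
have : \sum_(j in X :\ i) f j <= \sum_(j in X :\ i) g j by apply: leq_sum.
lia.
Qed.

End SumInBox.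

(** * Splitting integer points of dilated truncated boxes *)

Section LatticeBox.
Local Open Scope nat_scope.
Variables (I : finType) (X : {set I}) (c : I -> nat) (S : nat).

Definition lattice_box (k : nat) (a : I -> nat) :=
  (forall i, a i <= k * c i) /\ \sum_(i in X) a i <= k * S.

Definition lattice_inner (k : nat) (a : I -> nat) :=
  (forall i, 0 < a i < k * c i) /\ \sum_(i in X) a i < k * S.

(** The point [a / (k + 1)] meets all the constraints that the first summand has
    to satisfy, hence the bounds on it are compatible with the bounds on its
    sum. *)
Lemma lattice_box_split (k : nat) (a : I -> nat) :
  lattice_box k.+1 a -> exists a0 a' : I -> nat,
    [/\ lattice_box 1 a0, lattice_box k a' & forall i, a i = a0 i + a' i].
Proof.
move=> [ac aS].
have [||||a0 a0B a0S] := @box_sum_between _ X (fun i => a i - k * c i)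
    (fun i => minn (a i) (c i)) (\sum_(i in X) a i - k * S) S.
- by move=> i; have := ac i; lia.
- lia.
- have : k.+1 * \sum_(i in X) (a i - k * c i) <= \sum_(i in X) a i.
    by rewrite big_distrr /=; apply: leq_sum => i _; have := ac i; nia.
  nia.
- have : \sum_(i in X) a i <= k.+1 * \sum_(i in X) minn (a i) (c i).
    by rewrite big_distrr /=; apply: leq_sum => i _; have := ac i; nia.
  nia.
exists a0, (fun i => a i - a0 i); split; first by split=> [i|]; [have := a0B i; lia|lia].
  split=> [i|]; first by have := a0B i; lia.
  rewrite sumnB; first lia.
  by move=> i _; have := a0B i; lia.
by move=> i; have := a0B i; lia.
Qed.

Lemma lattice_box_sum (k : nat) (a : I -> nat) :
  lattice_box k a -> exists2 b : 'I_k -> I -> nat,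
    forall j, lattice_box 1 (b j) & forall i, a i = \sum_j b j i.
Proof.
elim: k a => [|k IH] a ka.
  exists (fun _ _ => 0) => [[]//|i]; rewrite big_ord0.
  by have [/(_ i)] := ka; lia.
have [a0 [a' [b0 /IH [b bb ba'] aE]]] := lattice_box_split ka.
exists (fun j i => if unlift ord0 j is Some j' then b j' i else a0 i).
  by move=> j; case: unliftP => [j' _|_]; [apply: bb|].
move=> i; rewrite aE big_ord_recl unlift_none ba'; congr addn.
by apply: eq_bigr => j _; rewrite liftK.
Qed.

(** The lower bounds imposed on the first summand are unsatisfiable exactly
    because of such a set: they may reach [c i - 1] on [Y] and are at least 1
    elsewhere, which adds up to [c(Y) - 2 #|Y| + #|X|]. *)
Definition low_block (Y : {set I}) :=
  \sum_(i in Y) c i < S /\ S + 2 * #|Y| <= \sum_(i in Y) c i + #|X|.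

(** The second summand cannot absorb [a] because of such a set: when [a]
    is as large as possible on [Y], what the first summand leaves there already
    exceeds the cut. *)
Definition high_block (Y : {set I}) :=
  S < \sum_(i in Y) c i /\ \sum_(i in Y) c i + #|X| + 1 < S + 2 * #|Y|.

Hypothesis c2 : forall i, 2 <= c i.
Hypothesis S_big : #|X| < S.

Definition lattice_level :=
  forall k a, 1 <= k -> lattice_inner k.+1 a -> exists a0 a' : I -> nat,
    [/\ lattice_inner 1 a0, lattice_box k a' & forall i, a i = a0 i + a' i].

Lemma sum_setId (P : pred I) (F : I -> nat) :
  \sum_(i in [set i in X | P i]) F i = \sum_(i in X) (if P i then F i else 0).
Proof. by rewrite -big_mkcondr; apply: eq_bigl => i; rewrite inE. Qed.

Lemma sum_block (Y : {set I}) (F : I -> nat) : Y \subset X ->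
  \sum_(i in X) (if i \in Y then F i else 1) =
  \sum_(i in Y) F i + (#|X| - #|Y|).
Proof.
move=> YX; rewrite (big_setID Y) /= (finset.setIidPr YX); congr addn.
  by apply: eq_bigr => i ->.
rewrite -cardsDS // -sum1_card; apply: eq_bigr => i.
by rewrite inE => /andP[/negPf -> _].
Qed.

Lemma sum_pred_cap (Y : {set I}) (k : nat) : 0 < k ->
  \sum_(i in Y) (k * c i).-1 + #|Y| = k * \sum_(i in Y) c i.
Proof.
move=> k0; rewrite -sum1_card -big_split big_distrr /=; apply: eq_bigr => i _.
by have := c2 i; nia.
Qed.

(** If the lower bounds add up to [S], take for [Y] the coordinates with
    [k * c i < a i].  Since [a] has sum below [k.+1 * S], the part [k * c(Y)] stays
    below [k * S], while [a i < k.+1 * c i] bounds the rest by [c(Y) - #|Y|]. *)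
Lemma lower_bounds_fit (k : nat) (a : I -> nat) : 0 < k ->
  lattice_inner k.+1 a ->
  ~ (exists2 Y : {set I}, Y \subset X & low_block Y) ->
  \sum_(i in X) maxn 1 (a i - k * c i) < S.
Proof.
move=> k0 [ac aS] noY; rewrite ltnNge; apply/negP => Sle; apply: noY.
pose Y := [set i in X | k * c i < a i].
have YX : Y \subset X by apply/fintype.subsetP => i; rewrite inE => /andP[].
have YXc := subset_leq_card YX.
exists Y => //.
have El : \sum_(i in X) maxn 1 (a i - k * c i) =
    \sum_(i in Y) (a i - k * c i) + (#|X| - #|Y|).
  rewrite -sum_block //; apply: eq_bigr => i iX; rewrite inE iX /=; case: ifP; lia.
have Ea : k * \sum_(i in Y) c i + \sum_(i in Y) (a i - k * c i) + (#|X| - #|Y|)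
    <= \sum_(i in X) a i.
  rewrite big_distrr -big_split /= -sum_block //; apply: leq_sum => i iX.
  by rewrite inE iX /=; have := ac i; case: ifP; lia.
have Eb : \sum_(i in Y) (a i - k * c i) + #|Y| <= \sum_(i in Y) c i.
  rewrite -sum1_card -big_split /=; apply: leq_sum => i.
  by rewrite inE => /andP[_ ?]; have := ac i; lia.
rewrite /low_block; nia.
Qed.

(** Otherwise [Y], the coordinates with [c i <= a i], carries an excess above
    [k * S].  The bounds [a i < k.+1 * c i] then give [S < c(Y)], and the bound on
    the sum of [a], whose other coordinates are positive, gives the upper bound on
    [c(Y)]. *)
Lemma upper_bounds_reach (k : nat) (a : I -> nat) : 0 < k ->
  lattice_inner k.+1 a ->
  ~ (exists2 Y : {set I}, Y \subset X & high_block Y) ->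
  \sum_(i in X) a i <= \sum_(i in X) minn (a i) (c i).-1 + k * S.
Proof.
move=> k0 [ac aS] noY; rewrite leqNgt; apply/negP => Sle; apply: noY.
pose Y := [set i in X | c i <= a i].
have YX : Y \subset X by apply/fintype.subsetP => i; rewrite inE => /andP[].
have YXc := subset_leq_card YX.
exists Y => //.
(* The excess of [a] over the upper bounds is carried by [Y]. *)
have Ea : \sum_(i in X) a i + \sum_(i in Y) c i =
    \sum_(i in X) minn (a i) (c i).-1 + \sum_(i in Y) a i + #|Y|.
  have sumY := sum_setId (fun i => c i <= a i).
  rewrite -sum1_card !sumY -!big_split; apply: eq_bigr => i _ /=.
  by have := c2 i; case: ifP; lia.
have El : \sum_(i in Y) a i + (#|X| - #|Y|) <= \sum_(i in X) a i.
  by rewrite -sum_block //; apply: leq_sum => i _; have := ac i; case: ifP; lia.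
have Eb : \sum_(i in Y) a i + #|Y| <= k.+1 * \sum_(i in Y) c i.
  rewrite -sum1_card big_distrr -big_split /=; apply: leq_sum => i _.
  by have := ac i; lia.
rewrite /high_block; nia.
Qed.

(** Give [a] its largest value on [Y] and 1 elsewhere: every first summand is then
    at least [c i - 1] on [Y]. *)
Lemma low_block_obstructs (Y : {set I}) : Y \subset X -> low_block Y ->
  ~ lattice_level.
Proof.
move=> YX lowY level; have YXc := subset_leq_card YX.
have [ltS leS] := lowY.
(* Large enough for [k.+1 * (S - c(Y))] to absorb the entries 1 outside [Y]. *)
pose k := #|X| + 1.
pose a i := if i \in Y then (k.+1 * c i).-1 else 1.
have aS := sum_block (fun i => (k.+1 * c i).-1) YX.
have cS := sum_pred_cap Y (ltn0Sn k).
have [||a0 [a' [[a0c a0S] [a'c a'S] aE]]] := level k a.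
- by rewrite /k; lia.
- split=> [i|]; first by rewrite /a /k; have := c2 i; case: ifP; nia.
  by rewrite aS; nia.
have : \sum_(i in X) (if i \in Y then (c i).-1 else 1) <= \sum_(i in X) a0 i.
  apply: leq_sum => i _; have := aE i; have := a'c i; have := a0c i.
  by rewrite /a; case: ifP; nia.
rewrite sum_block //; have := sum_pred_cap Y (ltn0Sn 0); rewrite mul1n.
under eq_bigr => i do rewrite mul1n.
lia.
Qed.

(** Give [a] the value 1 off [Y] and, on [Y], values whose sum makes that of [a]
    as large as the interior allows: then what the first summand leaves on [Y]
    exceeds [k * S]. *)
Lemma high_block_obstructs (Y : {set I}) : Y \subset X -> high_block Y ->
  ~ lattice_level.
Proof.
move=> YX [ltS leS] level; have YXc := subset_leq_card YX.
(* Large enough for the prescribed sum to fit below the upper bounds on [Y]. *)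
pose k := #|X| + 1.
have cS := sum_pred_cap Y (ltn0Sn k).
have [||b bB bS] := @box_sum_interpolation _ Y (fun=> 1)
    (fun i => (k.+1 * c i).-1) (k.+1 * S - 1 - #|X| + #|Y|).
- by move=> i; have := c2 i; rewrite /k; nia.
- by rewrite sum1_card; rewrite /k in cS *; nia.
pose a i := if i \in Y then b i else 1.
have aS := sum_block b YX.
have [||a0 [a' [[a0c a0S] [a'c a'S] aE]]] := level k a.
- by rewrite /k; lia.
- split=> [i|]; last by rewrite aS bS; rewrite /k in cS *; nia.
  by rewrite /a; have := bB i; have := c2 i; rewrite /k; case: ifP; nia.
have leY : \sum_(i in Y) a' i <= \sum_(i in X) a' i.
  by rewrite [in leqRHS](big_setID Y) /= (finset.setIidPr YX) leq_addr.
have : \sum_(i in Y) b i + #|Y| <= \sum_(i in Y) c i + \sum_(i in Y) a' i.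
  rewrite -sum1_card -!big_split /=; apply: leq_sum => i iY.
  by have := aE i; have := a0c i; rewrite /a iY; lia.
rewrite bS; nia.
Qed.

Lemma lattice_levelP : lattice_level <->
  ~ (exists2 Y : {set I}, Y \subset X & low_block Y) /\
  ~ (exists2 Y : {set I}, Y \subset X & high_block Y).
Proof.
split=> [level|[noL noH] k a k0 ka].
  by split=> -[Y YX bY]; [exact: low_block_obstructs bY level
                         |exact: high_block_obstructs bY level].
have lS := lower_bounds_fit k0 ka noL.
have uS := upper_bounds_reach k0 ka noH.
have [ac aS] := ka.
have [||||a0 a0B a0S] := @box_sum_between _ X (fun i => maxn 1 (a i - k * c i))
    (fun i => minn (a i) (c i).-1) (\sum_(i in X) a i - k * S) S.-1.
- by move=> i; have := ac i; have := c2 i; lia.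
- lia.
- lia.
- lia.
exists a0, (fun i => a i - a0 i); split.
- by split=> [i|]; [have := a0B i; have := c2 i; lia|lia].
- split=> [i|]; first by have := a0B i; lia.
  rewrite sumnB; first lia.
  by move=> i _; have := a0B i; lia.
by move=> i; have := a0B i; lia.
Qed.
End LatticeBox.

(** * Convex sets of row vectors *)

Local Open Scope classical_set_scope.

Section Convexity.
Variables (R : realType) (N : nat).
Local Notation V := 'rV[R]_N.
Implicit Types (C E : set V).

Lemma convex_setP C : @convex_set R V C <->
  forall x y (t : R), C x -> C y -> 0 <= t <= 1 -> C (t *: x + (1 - t) *: y).
Proof.
split=> [cC x y t Cx Cy /andP[t0 t1]|cC x y t /set_mem Cx /set_mem Cy].
  exact/set_mem/(cC x y (Itv01 t0 t1) (mem_set Cx) (mem_set Cy)).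
by apply/mem_set/cC => //; rewrite ge0 le1.
Qed.

Lemma convex_segment C x v (s t : R) : @convex_set R V C -> 0 < s -> 0 < t ->
  C (x + s *: v) -> C (x - t *: v) -> C x.
Proof.
move=> /convex_setP cC s0 t0 Cs Ct.
have st0 : 0 < s + t by rewrite addr_gt0.
have xE : (t / (s + t)) *: (x + s *: v) + (1 - t / (s + t)) *: (x - t *: v) = x.
  by apply/rowP => i; rewrite !mxE; field; rewrite gt_eqF.
rewrite -xE; apply: cC => //.
apply/andP; split; first by apply: divr_ge0; exact: ltW.
by rewrite ler_pdivrMr // mul1r lerDr ltW.
Qed.

Lemma hull_sub_convex E C : @convex_set R V C -> E `<=` C -> conv_hull E `<=` C.
Proof. by move=> cC EC; apply: smallest_sub. Qed.

(** Removing an extreme point [v] from the hull leaves a convex set; were [v] not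
    in [E], that smaller set would contain [E]. *)
Lemma vertex_hull_mem E v : @convex_set R V (conv_hull E) ->
  vertex (conv_hull E) v -> E v.
Proof.
move=> /convex_setP cP [Pv ext]; apply: contrapT => nEv.
suff cPv : @convex_set R V (conv_hull E `\ v).
  have EPv : E `<=` conv_hull E `\ v.
    move=> x Ex; split; first exact: sub_gen_smallest.
    by move=> /= xv; rewrite -xv in nEv.
  by have [_] := hull_sub_convex cPv EPv Pv; apply.
apply/convex_setP => x y t [Px xv] [Py yv] t01; split; first exact: cP.
move=> /= vE; have [t0|t0] := eqVneq t 0.
  by apply: yv; rewrite -vE t0 scale0r add0r subr0 scale1r.
have [t1|t1] := eqVneq t 1.
  by apply: xv; rewrite -vE t1 subrr scale0r addr0 scale1r.
have xy : x = y.
  apply: (ext x y t) => //; case/andP: t01 => t0' t1'.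
  by rewrite !lt_neqAle t0' t1' t1 eq_sym t0.
by apply: xv; rewrite -vE -xy -scalerDl addrC subrK scale1r.
Qed.

End Convexity.

(** * The truncated box as a lattice polytope *)

Section TruncatedBox.
Variables (R : realType) (N : nat) (X : {set 'I_N}) (c : 'I_N -> nat) (S : nat).
Local Notation V := 'rV[R]_N.
Implicit Types (x y : V) (a b : 'I_N -> nat).

Definition npoint a : V := \row_i (a i)%:R.

Lemma npoint_lattice a : lattice (npoint a).
Proof. by move=> i; rewrite mxE natr_int. Qed.

Lemma lattice_npoint x : lattice x -> (forall i, 0 <= x 0 i) ->
  exists a, x = npoint a.
Proof.
move=> lx x0; have /choice[a xa] i : exists k : nat, x 0 i = k%:R.
  by apply/natrP; rewrite natrEint lx x0.
by exists a; apply/rowP => i; rewrite mxE.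
Qed.

Definition sum_box : set V :=
  [set x | (forall i, 0 <= x 0 i <= (c i)%:R) /\ \sum_(i in X) x 0 i <= S%:R].

Definition open_sum_box : set V :=
  [set x | (forall i, 0 < x 0 i < (c i)%:R) /\ \sum_(i in X) x 0 i < S%:R].

Lemma sum_box_convex : @convex_set R V sum_box.
Proof.
apply/convex_setP => x y t [xc xS] [yc yS] /andP[t0 t1]; split=> [i|].
  rewrite !mxE; have /andP[x0 x1] := xc i; have /andP[y0 y1] := yc i.
  by apply/andP; split; nra.
under eq_bigr => i _ do rewrite !mxE.
by rewrite big_split -!mulr_sumr /=; nra.
Qed.

Lemma sum_delta i : \sum_(j in X) (j == i)%:R = (i \in X)%:R :> R.
Proof.
case: (boolP (i \in X)) => iX; last first.
  by rewrite big1 // => j jX; case: eqP => // ji; rewrite -ji jX in iX.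
by rewrite (big_setD1 i) //= eqxx big1 ?addr0 // => j; rewrite !inE => /andP[/negPf ->].
Qed.

(** A small move along a coordinate axis stays in the polytope when the centre is
    interior, which makes each inequality strict; [0 < S] covers the cut when [X]
    is empty. *)
Lemma interior_sum_box : (0 < S)%N -> sum_box° = open_sum_box.
Proof.
move=> S0; apply/seteqP; split=> x; last first.
  move=> [xc xS]; rewrite /interior.
  have cx i : (fun y : V => y 0 i) y @[y --> x] --> x 0 i.
    exact: coord_continuous.
  have cS : continuous (fun y : V => \sum_(i in X) y 0 i).
    apply: continuous_big => [|i _]; last exact: coord_continuous.
    exact: (@pseudometric_normed_Zmodule.add_continuous R R^o).
  have nS := @cvgr_lt R V (nbhs x) (nbhs_filter x) _ _ (cS x) _ xS.
  have nc : \forall y \near x, forall i, 0 <= (y : V) 0 i <= (c i)%:R.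
    apply: (@filter_forall V _ (fun i y => 0 <= y 0 i <= (c i)%:R) _ (nbhs_filter x)) => i; have /andP[x0 x1] := xc i.
    near=> y; apply/andP; split; apply: ltW; near: y.
      exact: cvgr_gt (cx i) _ x0.
    exact: cvgr_lt (cx i) _ x1.
  have := @filterI V (nbhs x) (nbhs_filter x) _ _ nS nc.
  by apply: (@filterS _ _ (nbhs_filter x)) => y [yS yc]; split=> //; exact: ltW.
move=> /nbhs_ballP[e /= e0 xe].
have e20 : 0 < e / 2 by rewrite divr_gt0.
have move_in i (d : R) : `|d| < e -> sum_box (x + d *: delta_mx 0 i).
  move=> de; apply: xe; split=> // k j; rewrite !mxE (ord1 k) /= /ball /=.
  rewrite opprD addNKr normrN normrM; apply: le_lt_trans de.
  by rewrite ler_piMr // normr_nat; case: (_ == _).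
have P i : sum_box (x + (e / 2) *: delta_mx 0 i).
  by apply: move_in; rewrite gtr0_norm //; lra.
have M i : sum_box (x + (- (e / 2)) *: delta_mx 0 i).
  by apply: move_in; rewrite normrN gtr0_norm //; lra.
split=> [i|].
  have [/(_ i) /andP[_ +] _] := P i; have [/(_ i) /andP[+ _] _] := M i.
  by rewrite !mxE !eqxx /= => ? ?; apply/andP; split; lra.
have [X0|[i iX]] := set_0Vmem X; first by rewrite X0 big_set0 ltr0n.
have [_] := P i.
under eq_bigr => j _ do rewrite !mxE eqxx /=.
by rewrite big_split /= -mulr_sumr sum_delta iX /=; lra.
Unshelve. all: end_near.
Qed.

Definition fractional x : {set 'I_N} := [set i | x 0 i \isn't a Num.int].

Lemma fractional_lt x y i : x 0 i \isn't a Num.int -> y 0 i \is a Num.int ->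
  (forall j, x 0 j \is a Num.int -> y 0 j \is a Num.int) ->
  (#|fractional y| < #|fractional x|)%N.
Proof.
move=> xi yi xy; apply/proper_card/properP; split.
  by apply/fintype.subsetP => j; rewrite !inE; apply: contra; apply: xy.
by exists i; rewrite !inE ?yi ?xi.
Qed.

Lemma fractional_bounds (r : R) (k : nat) : r \isn't a Num.int ->
  0 <= r <= k%:R ->
  exists2 l : nat, l%:R < r < l.+1%:R & (l.+1 <= k)%N.
Proof.
move=> ri /andP[r0 rk]; exists (Num.truncn r).
  have /andP[lr ->] := truncn_itv r0; rewrite andbT lt_neqAle lr andbT.
  by apply: contraNneq ri => <-; rewrite natr_int.
rewrite -(ltr_nat R); apply: le_lt_trans (_ : r < _).
  by have /andP[] := truncn_itv r0.
rewrite lt_neqAle rk andbT; apply: contraNneq ri => ->; exact: natr_int.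
Qed.

(** Moving along [e_i - e_j] keeps the sum over [X]; the move stops when the first
    of the two coordinates becomes an integer, before it can cross a bound since
    the bounds are integers. *)
Lemma shift_pair x i j : sum_box x -> i \in X -> j \in X -> i != j ->
  x 0 i \isn't a Num.int -> x 0 j \isn't a Num.int ->
  exists s, let y := x + s *: (delta_mx 0 i - delta_mx 0 j) in
  [/\ 0 < s, sum_box y & (#|fractional y| < #|fractional x|)%N].
Proof.
move=> [xc xS] iX jX ij xi xj.
have [li /andP[li0 li1] lic] := fractional_bounds xi (xc i).
have [lj /andP[lj0 lj1] ljc] := fractional_bounds xj (xc j).
have ci : (li.+1)%:R <= (c i)%:R :> R by rewrite ler_nat.
have cj : (lj.+1)%:R <= (c j)%:R :> R by rewrite ler_nat.
have l0i : 0 <= li%:R :> R by []. have l0j : 0 <= lj%:R :> R by [].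
pose s := Num.min (li.+1%:R - x 0 i) (x 0 j - lj%:R); exists s.
have s0 : 0 < s by rewrite lt_min !subr_gt0 li1 lj0.
have si : s <= li.+1%:R - x 0 i by rewrite ge_min lexx.
have sj : s <= x 0 j - lj%:R by rewrite ge_min lexx orbT.
set y := x + _.
have yE k : y 0 k = x 0 k + s * ((k == i)%:R - (k == j)%:R).
  by rewrite !mxE eqxx.
have yi : y 0 i = x 0 i + s by rewrite yE eqxx (negPf ij) subr0 mulr1.
have yj : y 0 j = x 0 j - s by rewrite yE eqxx eq_sym (negPf ij) sub0r mulrN1.
have yk k : k != i -> k != j -> y 0 k = x 0 k.
  by move=> /negPf ki /negPf kj; rewrite yE ki kj subrr mulr0 addr0.
split=> //.
  split=> [k|].
    have [->|ki] := eqVneq k i; first by rewrite yi; apply/andP; split; lra.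
    have [->|kj] := eqVneq k j; first by rewrite yj; apply/andP; split; lra.
    by rewrite yk.
  under eq_bigr => k _ do rewrite yE.
  by rewrite big_split /= -mulr_sumr sumrB !sum_delta iX jX subrr mulr0 addr0.
have yint k : x 0 k \is a Num.int -> y 0 k \is a Num.int.
  move=> xk; rewrite yk //.
    by apply: contraNneq xi => <-.
  by apply: contraNneq xj => <-.
have [smin|smin] := leP (li.+1%:R - x 0 i) (x 0 j - lj%:R).
  apply: (fractional_lt xi _ yint).
  by rewrite yi /s (min_idPl smin) addrC subrK natr_int.
apply: (fractional_lt xj _ yint).
by rewrite yj /s (min_idPr (ltW smin)) opprB addrC subrK natr_int.
Qed.

(** When [i] is the only non-integer coordinate in [X], rounding it up makes the
    sum over [X] an integer below [S + 1], so the cut still holds. *)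
Lemma shift_single x i : sum_box x -> x 0 i \isn't a Num.int ->
  (i \in X -> forall j, j \in X -> j != i -> x 0 j \is a Num.int) ->
  exists l : nat, [/\ l%:R < x 0 i < l.+1%:R,
    sum_box (x + (l%:R - x 0 i) *: delta_mx 0 i) &
    sum_box (x + (l.+1%:R - x 0 i) *: delta_mx 0 i)].
Proof.
move=> [xc xS] xi others.
have [l l01 lc] := fractional_bounds xi (xc i); exists l.
have cl : (l.+1)%:R <= (c i)%:R :> R by rewrite ler_nat.
have l0 : 0 <= l%:R :> R by [].
have [l1 l2] := andP l01.
have yE d k : (x + d *: delta_mx 0 i) 0 k = x 0 k + d * (k == i)%:R.
  by rewrite !mxE eqxx.
have box d : 0 <= x 0 i + d <= (c i)%:R ->
    forall k, 0 <= (x + d *: delta_mx 0 i) 0 k <= (c k)%:R.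
  move=> dc k; rewrite yE; have [->|_] := eqVneq k i; first by rewrite mulr1.
  by rewrite mulr0 addr0.
have sumE d : \sum_(k in X) (x + d *: delta_mx 0 i) 0 k =
    \sum_(k in X) x 0 k + d * (i \in X)%:R.
  by under eq_bigr => k _ do rewrite yE; rewrite big_split /= -mulr_sumr sum_delta.
split=> //; (split; first by apply: box; apply/andP; split; lra); rewrite sumE.
  by case: (i \in X); rewrite ?mulr1 ?mulr0; lra.
case: (boolP (i \in X)) => iX; last by rewrite mulr0 addr0.
(* The new sum is an integer below [S + 1]. *)
have /intrP[z zE] : \sum_(k in X :\ i) x 0 k \is a Num.int.
  by apply: rpred_sum => k; rewrite !inE => /andP[ki kX]; apply: others.
move: xS; rewrite (big_setD1 i) //= zE mulr1 => xS.
have : z%:~R + l%:Z%:~R < S%:Z%:~R :> R by rewrite -!pmulrn; lra.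
rewrite -rmorphD ltr_int -lezD1 -(ler_int R) !rmorphD /= -!pmulrn.
by rewrite -natr1; lra.
Qed.

(** Induction on the number of non-integer coordinates: two of them in [X] are moved
    against each other, a single one is moved alone. *)
Lemma sum_box_lattice_hull (C : set V) : @convex_set R V C ->
  (forall a, lattice_box X c S 1 a -> C (npoint a)) -> sum_box `<=` C.
Proof.
move=> cC latC x; have [n] := ubnP #|fractional x|.
elim: n x => // n IH x; rewrite ltnS => frn Px.
have IH' y : sum_box y -> (#|fractional y| < #|fractional x|)%N -> C y.
  by move=> Py fy; apply: IH => //; apply: leq_trans frn.
have [xc xS] := Px.
have [/existsP[i /existsP[j /and5P[iX jX ij xi xj]]]|nopair] :=
    boolP [exists i, exists j, [&& i \in X, j \in X, i != j,
      x 0 i \isn't a Num.int & x 0 j \isn't a Num.int]].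
  have [s [s0 Ps fs]] := shift_pair Px iX jX ij xi xj.
  rewrite eq_sym in ij; have [t [t0 Pt ft]] := shift_pair Px jX iX ij xj xi.
  apply: (convex_segment cC s0 t0 (IH' _ Ps fs)).
  by rewrite -scalerN opprB; apply: IH'.
have [/existsP[i xi]|int] := boolP [exists i, x 0 i \isn't a Num.int].
  have [|l [/andP[l1 l2] Pl Pu]] := shift_single Px xi.
    move=> iX j jX ji; apply: contraNT nopair => xj.
    apply/existsP; exists i; apply/existsP; exists j.
    by rewrite iX jX eq_sym ji xi xj.
  have frac (k : nat) : (#|fractional (x + (k%:R - x 0 i) *: delta_mx 0 i)%R| <
      #|fractional x|)%N.
    apply: (fractional_lt xi); first by rewrite !mxE !eqxx mulr1 addrC subrK natr_int.
    move=> j xj; rewrite !mxE; have [ji|_] := eqVneq j i; last by rewrite mulr0 addr0.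
    by rewrite ji (negPf xi) in xj.
  apply: (@convex_segment _ _ C x (delta_mx 0 i) (l.+1%:R - x 0 i) (x 0 i - l%:R)).
  - by [].
  - by rewrite subr_gt0.
  - by rewrite subr_gt0.
  - exact: IH'.
  - by rewrite -scaleNr opprB; apply: IH'.
have [||a xa] := @lattice_npoint x.
- by move=> i; apply: contraNT int => xi; apply/existsP; exists i.
- by move=> i; have /andP[] := xc i.
rewrite xa; apply: latC; split=> [i|].
  by have /andP[_] := xc i; rewrite xa mxE ler_nat mul1n.
move: xS; rewrite xa (eq_bigr (fun i => (a i)%:R)) => [|i _]; last by rewrite mxE.
by rewrite -natr_sum ler_nat mul1n.
Qed.

Lemma scale_sum_box_npoint (k : nat) a : (0 < k)%N ->
  sum_box (k%:R^-1 *: npoint a) <-> lattice_box X c S k a.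
Proof.
move=> k0; have kR : 0 < k%:R :> R by rewrite ltr0n.
have sumE : \sum_(i in X) (k%:R^-1 *: npoint a) 0 i =
    k%:R^-1 * (\sum_(i in X) a i)%N%:R.
  by rewrite natr_sum mulr_sumr; apply: eq_bigr => i _; rewrite !mxE.
rewrite /sum_box /= sumE ler_pdivrMl // -natrM ler_nat.
split=> -[ac aS]; split=> // i; have := ac i.
  by rewrite !mxE => /andP[_]; rewrite ler_pdivrMl // -natrM ler_nat.
rewrite !mxE ler_pdivrMl // -natrM ler_nat => ->.
by rewrite andbT mulr_ge0 // invr_ge0 ltW.
Qed.

Lemma scale_open_sum_box_npoint (k : nat) a : (0 < k)%N ->
  open_sum_box (k%:R^-1 *: npoint a) <-> lattice_inner X c S k a.
Proof.
move=> k0; have kR : 0 < k%:R :> R by rewrite ltr0n.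
have sumE : \sum_(i in X) (k%:R^-1 *: npoint a) 0 i =
    k%:R^-1 * (\sum_(i in X) a i)%N%:R.
  by rewrite natr_sum mulr_sumr; apply: eq_bigr => i _; rewrite !mxE.
rewrite /open_sum_box /= sumE ltr_pdivrMl // -natrM ltr_nat.
have coordE i : (0 < (k%:R^-1 *: npoint a) 0 i < (c i)%:R) =
    (0 < a i < k * c i)%N.
  by rewrite !mxE ltr_pdivrMl // -natrM ltr_nat pmulr_rgt0 ?invr_gt0 // ltr0n.
by split=> -[ac aS]; split=> // i; have := ac i; rewrite coordE.
Qed.

Lemma dilateP (P : set V) (k : nat) x : (0 < k)%N ->
  dilate k P x <-> P (k%:R^-1 *: x).
Proof.
move=> k0; have kR : k%:R != 0 :> R by rewrite pnatr_eq0 -lt0n.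
split=> [[y Py <-]|Px]; first by rewrite scalerA mulVf // scale1r.
by exists (k%:R^-1 *: x); rewrite // scalerA divff // scale1r.
Qed.

Lemma dilate_sum_box_npoint (k : nat) a : (0 < k)%N ->
  (dilate k sum_box `&` @lattice R N) (npoint a) <-> lattice_box X c S k a.
Proof.
move=> k0; split=> [[/(dilateP _ _ k0)/(scale_sum_box_npoint _ k0)]|ka] //.
split; last exact: npoint_lattice.
by apply/(dilateP _ _ k0)/(scale_sum_box_npoint _ k0).
Qed.

Lemma dilate_open_sum_box_npoint (k : nat) a : (0 < k)%N ->
  (dilate k open_sum_box `&` @lattice R N) (npoint a) <-> lattice_inner X c S k a.
Proof.
move=> k0; split=> [[/(dilateP _ _ k0)/(scale_open_sum_box_npoint _ k0)]|ka] //.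
split; last exact: npoint_lattice.
by apply/(dilateP _ _ k0)/(scale_open_sum_box_npoint _ k0).
Qed.

Lemma dilate1 (P : set V) : dilate 1 P = P.
Proof.
apply/seteqP; split=> [_ [x Px <-]|x Px]; first by rewrite scale1r.
by exists x => //; rewrite scale1r.
Qed.

Lemma open_sum_box_sub : open_sum_box `<=` sum_box.
Proof.
move=> x [xc xS]; split; last exact: ltW.
by move=> i; have /andP[x0 x1] := xc i; rewrite !ltW.
Qed.

Lemma dilate_lattice_npoint (k : nat) x : (0 < k)%N ->
  (dilate k sum_box `&` @lattice R N) x -> exists a, x = npoint a.
Proof.
move=> k0 [/(dilateP _ _ k0)[xc _] lx]; apply: lattice_npoint => // i.
by have /andP[] := xc i; rewrite mxE pmulr_rge0 // invr_gt0 ltr0n.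
Qed.

Lemma sum_box_hullE : sum_box = conv_hull (npoint @` [set a | lattice_box X c S 1 a]).
Proof.
apply/seteqP; split.
  apply: sum_box_lattice_hull => [|a ba].
    apply/convex_setP => x y t Hx Hy t01 C [cC EC].
    by move/convex_setP: (cC); apply => //; [apply: Hx|apply: Hy].
  by apply: sub_gen_smallest; exists a.
apply: hull_sub_convex; first exact: sum_box_convex.
move=> _ [a ba <-]; rewrite -[sum_box]dilate1.
by have [] : (dilate 1 sum_box `&` @lattice R N) (npoint a)
  by apply/dilate_sum_box_npoint.
Qed.

Lemma finite_lattice_box : finite_set (npoint @` [set a | lattice_box X c S 1 a]).
Proof.
pose M := (\sum_i c i)%N.
apply: (@sub_finite_set _ _
  ((fun f : {ffun 'I_N -> 'I_M.+1} => npoint (fun i => f i)) @` setT)); last first.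
  by apply: finite_image; exact: finite_finset.
move=> _ [a [ac _] <-]; exists [ffun i => inord (a i)] => //.
apply/rowP => i; rewrite !mxE ffunE inordK // ltnS.
apply: leq_trans (ac i) _; rewrite mul1n /M.
by rewrite (bigD1 i) //= leq_addr.
Qed.

Hypothesis c2 : forall i, (2 <= c i)%N.
Hypothesis S_big : (#|X| < S)%N.

Lemma full_dim_sum_box : full_dim sum_box.
Proof.
have S0 : (0 < S)%N by apply: leq_ltn_trans S_big.
have boxP a : lattice_box X c S 1 a -> sum_box (npoint a).
  by move/(@dilate_sum_box_npoint 1 a isT) => [+ _]; rewrite dilate1.
exists (npoint (fun=> 0%N)), (fun i => npoint (fun j => (j == i))); split.
- by apply: boxP; split=> [//|]; rewrite big1.
- move=> i; apply: boxP; split=> [j|].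
    by rewrite mul1n; apply: leq_trans (leq_b1 _) (ltnW (c2 j)).
  rewrite mul1n; apply: leq_trans S0.
  by have := sum_delta i; rewrite -natr_sum => /eqP; rewrite eqr_nat => /eqP ->; case: (_ \in _).
rewrite (_ : \matrix_i _ = 1%:M) ?unitmx1 //.
by apply/matrixP => i j; rewrite !mxE subr0 eq_sym.
Qed.

Lemma normal_sum_box : normal_polytope sum_box.
Proof.
split; first split.
- have [s sE] := (finite_seqP _).1 finite_lattice_box.
  by exists s; rewrite -sE -sum_box_hullE.
- have cP := sum_box_convex; rewrite sum_box_hullE in cP *.
  by move=> v /(vertex_hull_mem cP)[a _ <-]; exact: npoint_lattice.
- exact: full_dim_sum_box.
move=> k x k2 kx; have k0 : (0 < k)%N by apply: ltnW.
have [a xa] := dilate_lattice_npoint k0 kx; rewrite xa in kx *.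
have [b b1 ab] := lattice_box_sum ((dilate_sum_box_npoint _ k0).1 kx).
exists (fun j => npoint (b j)).
  by move=> j; rewrite -[sum_box]dilate1; apply/dilate_sum_box_npoint.
apply/rowP => i; rewrite mxE ab natr_sum summxE.
by apply: eq_bigr => j _; rewrite mxE.
Qed.

Lemma level_star_sum_box : level_star sum_box <-> lattice_level X c S.
Proof.
have S0 : (0 < S)%N by apply: leq_ltn_trans S_big.
have openD k : dilate k open_sum_box `<=` dilate k sum_box.
  by move=> _ [x Px <-]; exists x => //; exact: open_sum_box_sub.
split.
  move=> [_ _ lev] k a k0 ka; rewrite interior_sum_box // in lev.
  have [//||x0 [x' [Px0 Px' xE]]] := lev k.+1 (npoint a).
    exact/dilate_open_sum_box_npoint.
  rewrite -[open_sum_box]dilate1 in Px0.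
  have [a0 x0E] : exists a0, x0 = npoint a0.
    by apply: (@dilate_lattice_npoint 1) => //; case: Px0 => /openD.
  have [a' x'E] := dilate_lattice_npoint k0 Px'.
  rewrite x0E x'E in Px0 Px' xE.
  exists a0, a'; split; [exact/dilate_open_sum_box_npoint|exact/dilate_sum_box_npoint|].
  move=> i; apply/eqP; rewrite -(eqr_nat R) natrD.
  by move/rowP/(_ i): xE; rewrite !mxE => ->.
move=> lev; rewrite /level_star interior_sum_box //; split.
- exact: normal_sum_box.
- exists (npoint (fun=> 1%N)); rewrite -[open_sum_box]dilate1.
  by apply/dilate_open_sum_box_npoint => //; split=> [i|]; rewrite mul1n ?c2 // sum1_card.
case=> // k x k1 kx; rewrite ltnS in k1.
have [a xa] : exists a, x = npoint a.
  by apply: (@dilate_lattice_npoint k.+1) => //; case: kx => /openD.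
rewrite xa in kx *.
have [a0 [a' [a01 a'k aE]]] := lev k a k1 ((dilate_open_sum_box_npoint _ (ltn0Sn k)).1 kx).
exists (npoint a0), (npoint a'); split.
- by rewrite -[open_sum_box]dilate1; apply/dilate_open_sum_box_npoint.
- exact/dilate_sum_box_npoint.
by apply/rowP => i; rewrite !mxE aE natrD.
Qed.

End TruncatedBox.

(** * Monomial ideals *)

Section IdealGen.
Variable S : comNzRingType.
Implicit Types (E : set S) (p q r : S).

Lemma ideal_gen_mem E p : E p -> ideal_gen E p.
Proof.
move=> Ep; exists [:: (1, p)]; last by rewrite big_seq1 mul1r.
by move=> rg; rewrite inE => /eqP ->.
Qed.

Lemma ideal_gen0 E : ideal_gen E 0.
Proof. by exists [::]; rewrite ?big_nil. Qed.

Lemma ideal_genD E p q : ideal_gen E p -> ideal_gen E q -> ideal_gen E (p + q).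
Proof.
move=> [s sE ->] [t tE ->]; exists (s ++ t); last by rewrite big_cat.
by move=> rg; rewrite mem_cat => /orP[/sE|/tE].
Qed.

Lemma ideal_genM E r p : ideal_gen E p -> ideal_gen E (r * p).
Proof.
move=> [s sE ->]; exists [seq (r * rg.1, rg.2) | rg <- s].
  by move=> rg /mapP[x /sE xE ->].
by rewrite big_map mulr_sumr; apply: eq_bigr => i _ /=; rewrite mulrA.
Qed.

Lemma ideal_gen_sub E F : E `<=` ideal_gen F -> ideal_gen E `<=` ideal_gen F.
Proof.
move=> EF p [s sE ->]; rewrite big_seq; apply: (big_ind (ideal_gen F)).
- exact: ideal_gen0.
- exact: ideal_genD.
- by move=> rg /sE/EF; exact: ideal_genM.
Qed.

End IdealGen.

Section Monomials.
Variables (K : fieldType) (N : nat).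
Local Notation S := (mpoly.mpoly N K).
Local Notation mon := (mpoly.multinom N).
Local Notation "''x^' a" := (@mpoly.mpolyX N K a) (at level 8, a at level 2).
Local Notation "a <=m b" := (forall i, (a i <= b i)%N) (at level 70).
Implicit Types (a b u v : mon) (U V : set mon) (p q : S).

Definition mon_of (f : 'I_N -> nat) : mon := Multinom [tuple f i | i < N].

Lemma mon_ofE f i : mon_of f i = f i.
Proof. exact: mnmE. Qed.

Lemma monX_neq0 a : 'x^a != 0.
Proof.
by apply/eqP => /(congr1 (mcoeff a)) /eqP; rewrite mcoeffX mcoeff0 eqxx oner_eq0.
Qed.

Lemma mcoeffX_neq0 a u : mcoeff u 'x^a != 0 -> u = a.
Proof. by rewrite mcoeffX; case: (eqVneq a u) => //=; rewrite eqxx. Qed.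

Lemma mcoeffM_neq0 p q u : mcoeff u (p * q) != 0 ->
  exists v w, [/\ u = mnm_add v w, mcoeff v p != 0 & mcoeff w q != 0].
Proof.
move=> nz; apply: contrapT => no; case/negP: nz; rewrite mcoeffM.
apply/eqP/big1 => k /eqP uE; apply/eqP; apply/negPn/negP.
rewrite mulf_eq0 negb_or => /andP[? ?]; apply: no.
by exists (bmnm k.1), (bmnm k.2).
Qed.

(** Monomials of an element of an ideal are multiples of monomials of the
    generators; this reduces membership questions to exponents. *)
Lemma ideal_gen_mcoeff (E : set S) p u : ideal_gen E p -> mcoeff u p != 0 ->
  exists q v, [/\ E q, mcoeff v q != 0 & v <=m u].
Proof.
move=> [s sE ->]; rewrite raddf_sum /= => nz.
have [rg sg] : exists2 rg, rg \in s & mcoeff u (rg.1 * rg.2) != 0.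
  apply/hasP; apply: contraNT nz => /hasPn z.
  by rewrite big_seq big1 // => i /z /negPn /eqP.
move=> /mcoeffM_neq0[v [w [-> _ wn]]]; exists rg.2, w; split => //.
  exact: sE.
by move=> i; rewrite mnmDE leq_addl.
Qed.

Lemma monX_ideal E a u : ideal_gen E ('x^a : S) -> a <=m u ->
  ideal_gen E ('x^u : S).
Proof.
move=> Ea au; have -> : 'x^u = 'x^(mnm_sub u a) * 'x^a.
  by rewrite -mpolyXD submK //; apply/mnm_lepP.
exact: ideal_genM.
Qed.

Lemma mem_mon_ideal U u : mon_ideal U ('x^u : S) <-> exists2 a, U a & a <=m u.
Proof.
split=> [Uu|[a Ua au]]; last first.
  by apply: monX_ideal au; apply: ideal_gen_mem; exists a.
have [|q [v [[a Ua <-] vq vu]]] := ideal_gen_mcoeff (u := u) Uu.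
  by rewrite mcoeffX eqxx oner_eq0.
by exists a => //; rewrite -(mcoeffX_neq0 vq).
Qed.

Lemma mon_ideal_sub U V : (forall a, U a -> exists2 b, V b & b <=m a) ->
  @mon_ideal K N U `<=` mon_ideal V.
Proof.
move=> UV; apply: ideal_gen_sub => _ [a Ua <-].
by apply/mem_mon_ideal; apply: UV.
Qed.

Lemma monX_dvd a u : ring_dvd ('x^a : S) 'x^u <-> a <=m u.
Proof.
split=> [[r uE]|au].
  have : mon_ideal [set a] ('x^u : S).
    by rewrite uE; apply: ideal_genM; apply: ideal_gen_mem; exists a.
  by move=> /mem_mon_ideal[_ ->].
by exists 'x^(mnm_sub u a); rewrite -mpolyXD submK //; apply/mnm_lepP.
Qed.

(** Any monomial generating set [V] must contain each [u] of the antichain: [u] is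
    above some [a] in [V], which is above some [b] in [U], and [b = u]. *)
Lemma min_mon_gens_antichain U :
  (forall a b, U a -> U b -> a <=m b -> a = b) ->
  min_mon_gens (@mon_ideal K N U) = U.
Proof.
move=> antiU.
have subU V : @mon_ideal K N V = mon_ideal U -> U `<=` V.
  move=> VU u Uu.
  have /mem_mon_ideal[a Va au] : mon_ideal V ('x^u : S).
    by rewrite VU; apply/mem_mon_ideal; exists u.
  have /mem_mon_ideal[b Ub ba] : mon_ideal U ('x^a : S).
    by rewrite -VU; apply/mem_mon_ideal; exists a.
  have bu := antiU b u Ub Uu (fun i => leq_trans (ba i) (au i)).
  suff -> : u = a by [].
  by apply/mnmP => i; apply/eqP; rewrite eqn_leq au andbT -bu ba.
apply: xget_unique; first by split=> // V VU /subU UV; apply/seteqP.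
by move=> V [VU minV]; apply/esym/minV => //; apply: subU.
Qed.

Lemma bounded_partE (c : 'I_N -> nat) (J : set S) :
  bounded_part c J = mon_ideal [set a | J 'x^a /\ a <=m c].
Proof.
congr ideal_gen; apply/seteqP; split=> [_ [a [-> Ja ac]]|_ [a [Ja ac] <-]].
  by exists a.
by exists a.
Qed.

Lemma mon_ideal_neq0 U : @mon_ideal K N U <> [set 0] <-> exists a, U a.
Proof.
split=> [nz|[a Ua] U0]; last first.
  have : mon_ideal U ('x^a : S) by apply/mem_mon_ideal; exists a.
  by rewrite U0 => /= /eqP; rewrite (negPf (monX_neq0 a)).
apply: contrapT => noU; apply: nz; apply/seteqP; split=> [p [s sU ->]|p -> ].
  rewrite big_seq big1 // => rg /sU[a Ua _]; case: noU; by exists a.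
exact: ideal_gen0.
Qed.

End Monomials.

(** * Powers of the edge ideal of a complete bipartite graph *)

Section BipartiteIdeal.
Variables (K : fieldType) (m n : nat).
Local Notation S := (mpoly.mpoly (m + n) K).
Local Notation mon := (mpoly.multinom (m + n)).
Local Notation "''x^' a" := (@mpoly.mpolyX (m + n) K a) (at level 8, a at level 2).
Local Notation "a <=m b" := (forall i, (a i <= b i)%N) (at level 70).
Local Notation L := (lpart m n).
Local Notation Q := (rpart m n).
Local Notation I := (@edge_ideal K (m + n) (complete_bipartite m n)).

Lemma mon_sumD (X : {set 'I_(m + n)}) (a b : mon) :
  (\sum_(i in X) mnm_add a b i = \sum_(i in X) a i + \sum_(i in X) b i)%N.
Proof. by rewrite -big_split; apply: eq_bigr => i _; rewrite mnmDE. Qed.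

Lemma mon_sum1 (X : {set 'I_(m + n)}) i :
  (\sum_(j in X) mnm1 i j = (i \in X))%N.
Proof.
under eq_bigr => j _ do rewrite mnm1E.
case: (boolP (i \in X)) => iX; last first.
  by rewrite big1 // => j jX; case: eqP => // ij; rewrite ij jX in iX.
rewrite (bigD1 i) //= eqxx big1 // => j /andP[_]; rewrite eq_sym.
by move=> /negPf ->.
Qed.

Lemma in_rpart i : (i \in Q) = (i \notin L).
Proof. by rewrite inE. Qed.

Lemma edge_ideal_mcoeff (p : S) u : I p -> mcoeff u p != 0 ->
  (0 < \sum_(i in L) u i)%N /\ (0 < \sum_(i in Q) u i)%N.
Proof.
move=> Ip /(ideal_gen_mcoeff Ip)[_ [v [[i [j [adj ->]]]]]].
rewrite -mpolyXD => /mcoeffX_neq0 -> le.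
have leS (X : {set 'I_(m + n)}) :
    ((i \in X) + (j \in X) <= \sum_(k in X) u k)%N.
  by rewrite -!mon_sum1 -mon_sumD; apply: leq_sum => k _; apply: le.
move: (leS L) (leS Q); rewrite !in_rpart.
by move: adj; rewrite /complete_bipartite; do 2 case: (_ \in L) => //=; lia.
Qed.

Lemma edge_pow_mcoeff q (p : S) u : ideal_pow I q p -> mcoeff u p != 0 ->
  (q <= \sum_(i in L) u i)%N /\ (q <= \sum_(i in Q) u i)%N.
Proof.
elim: q p u => // q IH p u Ip /(ideal_gen_mcoeff Ip).
move=> [_ [v [[x Ix [y Iy <-]] /mcoeffM_neq0[v1 [v2 [vE xn yn]]] vu]]].
have [] := edge_ideal_mcoeff Ix xn; have [] := IH _ _ Iy yn.
have leS (X : {set 'I_(m + n)}) :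
    (\sum_(i in X) v1 i + \sum_(i in X) v2 i <= \sum_(k in X) u k)%N.
  by rewrite -mon_sumD -vE; apply: leq_sum => k _; apply: vu.
by move: (leS L) (leS Q); lia.
Qed.

(** Each edge contributes one variable to each side; conversely, as all pairs
    across are edges, one vertex from each side can be peeled off [q] times. *)
Lemma monX_edge_pow q u : ideal_pow I q ('x^u : S) <->
  (q <= \sum_(i in L) u i)%N /\ (q <= \sum_(i in Q) u i)%N.
Proof.
split=> [Iu|].
  by apply: edge_pow_mcoeff Iu _; rewrite mcoeffX eqxx oner_eq0.
elim: q u => // q IH u [qL qQ].
have pos (X : {set 'I_(m + n)}) : (0 < \sum_(i in X) u i)%N ->
    exists2 i, i \in X & (0 < u i)%N.
  rewrite lt0n sum_nat_eq0 => /forallPn[i]; rewrite negb_imply -lt0n.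
  by move=> /andP[]; exists i.
have [i iL ui] := pos L (leq_ltn_trans (leq0n _) qL).
have [j jQ uj] := pos Q (leq_ltn_trans (leq0n _) qQ).
pose e := mnm_add (mnm1 i) (mnm1 j).
have ij : i != j by apply: contraTneq iL => ->; rewrite -in_rpart.
have eu : e <=m u.
  move=> k; rewrite mnmDE !mnm1E.
  case: (eqVneq i k) => [ik|_]; case: (eqVneq j k) => [jk|_] //.
  - by rewrite ik jk eqxx in ij.
  - by rewrite -ik.
  - by rewrite -jk.
have uE : u = mnm_add e (mnm_sub u e).
  by rewrite addmC submK //; apply/mnm_lepP.
rewrite uE mpolyXD; apply: ideal_gen_mem; exists 'x^e.
  apply: ideal_gen_mem; exists i, j; split; last by rewrite mpolyXD.
  by rewrite /complete_bipartite iL; move: jQ; rewrite in_rpart => /negPf ->.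
exists 'x^(mnm_sub u e) => //; apply: IH.
have sumE (X : {set 'I_(m + n)}) : (\sum_(k in X) u k = (i \in X) + (j \in X) +
    \sum_(k in X) mnm_sub u e k)%N.
  by rewrite -!mon_sum1 -!mon_sumD -uE.
move: jQ qL qQ; rewrite !sumE !in_rpart iL => /negPf ->.
by move=> /= ? ?; split; lia.
Qed.

Variable c : 'I_(m + n) -> nat.
Hypothesis hc_sum : (csum c Q < csum c L)%N.
Hypothesis hc_pos : (0 < csum c Q)%N.

Lemma nonzero_edge_pow q : nonzero_power c I q <-> (q <= csum c Q)%N.
Proof.
rewrite /nonzero_power bounded_partE mon_ideal_neq0; split.
  move=> [a [/monX_edge_pow[_ qQ] ac]]; apply: leq_trans qQ _.
  by apply: leq_sum => i _; apply: ac.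
move=> qQ; exists (mon_of c); split; last by move=> i; rewrite mon_ofE.
have sumc (X : {set 'I_(m + n)}) : (\sum_(i in X) mon_of c i)%N = csum c X.
  by apply: eq_bigr => i _; rewrite mon_ofE.
by apply/monX_edge_pow; rewrite !sumc; split=> //; apply: leq_trans (ltnW hc_sum).
Qed.

Lemma delta_bipartite : delta c I = csum c Q.
Proof.
have d : is_delta c I (csum c Q).
  by split=> // [|q _]; [apply/nonzero_edge_pow|move=> /nonzero_edge_pow].
apply: xget_unique => // q [q1 qn qmax].
apply/eqP; rewrite eqn_leq; apply/andP; split.
  exact/nonzero_edge_pow.
by apply: qmax => //; apply/nonzero_edge_pow.
Qed.

(** A bounded monomial of degree at least [csum c Q] on [Q] fills [Q]; lowering its
    exponents on [L] until their sum is [csum c Q] gives a generator below it. *)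
Lemma calB_bipartite : calB K (complete_bipartite m n) c =
  [set a | [/\ a <=m c, (\sum_(i in L) a i = csum c Q)%N &
               (forall i, i \in Q -> a i = c i)]].
Proof.
set U := RHS.
rewrite /calB delta_bipartite bounded_partE.
rewrite [X in min_mon_gens X](_ : _ = mon_ideal U); last first.
  apply/seteqP; split; apply: mon_ideal_sub => a.
    move=> [/monX_edge_pow[aL aQ] ac].
    have aQc i : i \in Q -> a i = c i.
      by apply: eq_of_sum_le => //; exact: ac.
    have [||b bB bS] := @box_sum_interpolation _ L (fun=> 0%N) a (csum c Q).
    - by [].
    - by rewrite big1.
    exists (mon_of (fun i => if i \in L then b i else c i)).
      split=> [i|| i]; rewrite ?mon_ofE.
      + by case: ifP => // _; have /andP[_] := bB i; move=> /leq_trans; apply.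
      + by rewrite -bS; apply: eq_bigr => i iL; rewrite mon_ofE iL.
      + by rewrite in_rpart => /negPf ->.
    move=> i; rewrite mon_ofE; case: ifPn => [_|iL].
      by have /andP[] := bB i.
    by rewrite aQc // in_rpart.
  move=> [ac aL aQ]; exists a => //; split => //; apply/monX_edge_pow.
  by rewrite aL; split => //; rewrite leq_eqVlt; apply/orP; left; apply/eqP/esym/eq_bigr.
apply: min_mon_gens_antichain => a b [_ aL aQ] [_ bL bQ] ab.
apply/mnmP => i; case: (boolP (i \in L)) => iL; last first.
  by rewrite aQ ?bQ ?in_rpart.
by apply: (eq_of_sum_le ab _ iL); rewrite aL bL.
Qed.

Lemma calD_bipartite : calD K (complete_bipartite m n) c =
  [set a | a <=m c /\ (\sum_(i in L) a i <= csum c Q)%N].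
Proof.
rewrite /calD calB_bipartite; apply/seteqP; split=> [a [u [uc uL uQ]]|a [ac aL]].
  move=> /monX_dvd au; split; first by move=> i; apply: leq_trans (au i) (uc i).
  by rewrite -uL; apply: leq_sum => i _; apply: au.
have [||b bB bS] := @box_sum_interpolation _ L a c (csum c Q) => //.
  by rewrite aL ltnW.
exists (mon_of (fun i => if i \in L then b i else c i)).
  split=> [i|| i]; rewrite ?mon_ofE.
  + by case: ifP => // _; have /andP[] := bB i.
  + by rewrite -bS; apply: eq_bigr => i iL; rewrite mon_ofE iL.
  + by rewrite in_rpart => /negPf ->.
apply/monX_dvd => i; rewrite mon_ofE; case: ifPn => // iL.
by have /andP[] := bB i.
Qed.

End BipartiteIdeal.

(** * The polytope of a complete bipartite graph *)

Section CompleteBipartitePolytope.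
Variables (K : fieldType) (R : realType) (m n : nat) (c : 'I_(m + n) -> nat).
Local Notation L := (lpart m n).
Local Notation Q := (rpart m n).
Local Notation T := (csum c Q).

Lemma card_lpart : #|L| = m.
Proof.
rewrite -sum1_card big_mkcond big_split_ord /= [X in (_ + X)%N]big1 => [|i _].
  rewrite (eq_bigr (fun=> 1%N)) => [|i _]; first by rewrite sum1_card card_ord addn0.
  by rewrite inE /= ltn_ord.
by rewrite inE /= ltnNge leq_addr.
Qed.

Lemma in_setB i : (i \in setB c) = (i \in L) && (c i != T).
Proof. by rewrite !inE; case: (i < m)%N; rewrite ?andbT ?andbF. Qed.

Hypothesis hc_le : forall i, i \in L -> (c i <= T)%N.

Lemma ineq_polytopeE : ineq_polytope R c = @sum_box R (m + n) L c T.
Proof.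
have inA i : (i \in setA c) = (i \in L) && (c i == T) by rewrite !inE.
apply/seteqP; split=> x [].
  move=> xQ xB xA xS; split=> // i.
  case: (boolP (i \in L)) => iL; last by apply: xQ; rewrite in_rpart.
  have [ci|ci] := eqVneq (c i) T; last by apply: xB; rewrite in_setB iL.
  rewrite xA ?inA ?iL ?ci //=; apply: le_trans xS.
  rewrite (big_setD1 i) //= lerDl; apply: sumr_ge0 => j.
  rewrite !inE => /andP[_ jL].
  have [cj|cj] := eqVneq (c j) T; first by apply: xA; rewrite inA cj eqxx inE jL.
  by have /andP[] : 0 <= x 0 j <= (c j)%:R by apply: xB; rewrite in_setB cj inE jL.
by move=> xc xS; split=> // i _; have /andP[] := xc i.
Qed.

Lemma convDE : (0 < T)%N -> (T < csum c L)%N ->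
  convD K R (complete_bipartite m n) c = @sum_box R (m + n) L c T.
Proof.
move=> T0 TL; rewrite sum_box_hullE /convD (calD_bipartite K TL T0).
congr conv_hull; apply/seteqP; split=> [_ [a [ac aS] <-]|_ [a [ac aS] <-]].
  by exists a => //; split=> [i|]; rewrite mul1n.
rewrite mul1n in aS; exists (mon_of a).
  split=> [i|]; first by rewrite mon_ofE -[c i]mul1n.
  by under eq_bigr => i _ do rewrite mon_ofE.
by apply/rowP => i; rewrite !mxE mon_ofE.
Qed.

Hypothesis c2 : forall i, (2 <= c i)%N.

(** A vertex [i] with [c i = T] cannot lie in a high block [Y]: the other vertices
    would have [c(Y :\ i) + m + 1 < 2 #|Y|], although each has capacity at least
    2. *)
Lemma high_blockP : (0 < m)%N ->
  (exists2 Y : {set 'I_(m + n)}, Y \subset L & high_block L c T Y) <->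
  exists X : {set 'I_(m + n)}, [/\ X != finset.set0, X \subset setB c &
    T%:Z < (csum c X)%:Z < T%:Z - m%:Z + 2 * #|X|%:Z - 1].
Proof.
move=> m0; rewrite /high_block card_lpart; split=> [[Y YL [TY YT]]|[X [_ XB bX]]].
  rewrite -/(csum c Y) in TY YT.
  exists Y; split; last by lia.
    by apply: contraTneq TY => ->; rewrite /csum big_set0.
  apply/fintype.subsetP => i iY; rewrite in_setB (fintype.subsetP YL i iY) /=.
  apply/negP => /eqP ciT.
  have := cardsD1 i Y; rewrite iY => cardY.
  have sumY : csum c Y = (c i + csum c (Y :\ i))%N by rewrite /csum (big_setD1 i).
  have : (2 * #|Y :\ i| <= csum c (Y :\ i))%N.
    by rewrite mulnC -sum_nat_const; apply: leq_sum => j _; apply: c2.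
  lia.
exists X; last by rewrite -/(csum c X); lia.
by apply: fintype.subset_trans XB _; apply: finset.subsetDl.
Qed.

(** The correspondence is complementation in [L]; the complement of a low block is
    nonempty because [L] exceeds [T]. *)
Lemma low_blockP : (T < csum c L)%N ->
  (exists2 Y : {set 'I_(m + n)}, Y \subset L & low_block L c T Y) <->
  exists X : {set 'I_(m + n)}, [/\ X != finset.set0, X \subset L &
    (csum c L)%:Z - (csum c X)%:Z < T%:Z
      <= 2 * #|X|%:Z + (csum c L)%:Z - (csum c X)%:Z - m%:Z].
Proof.
move=> TL.
have sumL (X : {set 'I_(m + n)}) : X \subset L -> (csum c L = csum c X + csum c (L :\: X))%N.
  by move=> XL; rewrite /csum (big_setID X) /= (finset.setIidPr XL).
have cardL (X : {set 'I_(m + n)}) : X \subset L -> (m = #|X| + #|L :\: X|)%N.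
  by move=> XL; have := cardsID X L; rewrite (finset.setIidPr XL) card_lpart.
rewrite /low_block card_lpart; split=> [[Y YL [YT TY]]|[X [_ XL bX]]].
  rewrite -/(csum c Y) in YT TY; have := sumL _ YL; have := cardL _ YL.
  move=> cY sY; exists (L :\: Y); split.
  - apply: contraTneq YT => Y0.
    by have : csum c (L :\: Y) = 0%N; [rewrite Y0 /csum big_set0|lia].
  - exact: finset.subsetDl.
  - by lia.
have := sumL _ XL; have := cardL _ XL => cX sX.
exists (L :\: X); first exact: finset.subsetDl.
by rewrite -/(csum c _); lia.
Qed.

End CompleteBipartitePolytope.

Theorem theorem2p5 (K : fieldType) (R : realType) (m n : nat)
    (hm : (1 <= m)%N) (hn : (1 <= n)%N) (c : 'I_(m + n) -> nat)
    (hc_pos : forall i, (0 < c i)%N)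
    (hc_sum : (csum c (rpart m n) < csum c (lpart m n))%N)
    (hc_m : (m + 1 <= csum c (rpart m n))%N)
    (hc_le : forall i, i \in lpart m n -> (c i <= csum c (rpart m n))%N)
    (hc_two : forall i, i \in (setB c :|: rpart m n)%SET -> (2 <= c i)%N) :
  convD K R (complete_bipartite m n) c = ineq_polytope R c /\
  (level_star (convD K R (complete_bipartite m n) c) <->
    (~ exists X : {set 'I_(m + n)},
         [/\ X != finset.set0, X \subset setB c &
             (csum c (rpart m n))%:Z < (csum c X)%:Z
               < (csum c (rpart m n))%:Z - m%:Z + 2 * #|X|%:Z - 1]) /\
    (~ exists X : {set 'I_(m + n)},
         [/\ X != finset.set0, X \subset lpart m n &
             (csum c (lpart m n))%:Z - (csum c X)%:Z
               < (csum c (rpart m n))%:Z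
               <= 2 * #|X|%:Z + (csum c (lpart m n))%:Z - (csum c X)%:Z
                    - m%:Z])).
Proof.
(* On [A] the capacity is that of the right side, which is at least [m + 1]. *)
have c2 i : (2 <= c i)%N.
  case: (boolP (i \in (setB c :|: rpart m n)%SET)) => [/hc_two //|].
  rewrite !inE; case im: (i < m)%N => //=; rewrite andbT orbF negbK => /eqP ->.
  by lia.
have T0 : (0 < csum c (rpart m n))%N by lia.
rewrite (convDE K R T0 hc_sum) ineq_polytopeE //; split=> //.
have cardT : (#|lpart m n| < csum c (rpart m n))%N by rewrite card_lpart; lia.
rewrite level_star_sum_box // lattice_levelP // and_comm.
by rewrite (high_blockP c2 hm) (low_blockP hc_sum).
Qed.
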